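(* For every triple of positive integers $k,\ell,r$ with $k\geq 3$ and $r\geq 3$, there exists a positive integer $N=N(k,\ell,r)$ such that for every integer $n\geq N$: (i) if $k<r$, then $rx_{k,\ell}(K_{r\times n})=k$; (ii) if $k\geq r$ and $\ell\leq \dfrac{\binom{r}{2}\lceil k/r\rceil^{2}}{\lfloor k/r\rfloor}$, then $rx_{k,\ell}(K_{r\times n})\in\{k,k+1\}$; (iii) if $k\geq r$ and $\ell> \dfrac{\binom{r}{2}\lceil k/r\rceil^{2}}{\lfloor k/r\rfloor}$, then $rx_{k,\ell}(K_{r\times n})=k+1$.
   Context: All graphs are undirected, finite and simple. $K_{r\times n}$ is the complete multipartite graph with $r$ vertex classes, each of size $n$. An edge-coloring of a graph $G$ with $t$ colors is any map $c:E(G)\to\{1,\dots,t\}$ (adjacent edges may receive the same color). A tree $T$ that is a subgraph of $G$ is a rainbow tree if no two edges of $T$ have the same color. For $S\subseteq V(G)$, an $S$-tree is a tree in $G$ containing all vertices of $S$, and a rainbow $S$-tree is an $S$-tree that is a rainbow tree. Rainbow $S$-trees $T_1,\dots,T_\ell$ are internally disjoint if $E(T_i)\cap E(T_j)=\emptyset$ and $V(T_i)\cap V(T_j)=S$ for all $1\le i,j\le \ell$ with $i\neq j$. The $(k,\ell)$-rainbow index $rx_{k,\ell}(G)$ is the minimum number of colors needed in an edge-coloring of $G$ such that for every set $S$ of $k$ vertices of $G$ there exist $\ell$ internally disjoint rainbow $S$-trees. *)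

(* Defs.v *)
From HB Require Import structures.
From mathcomp Require Import all_boot all_order all_algebra.
Set Implicit Arguments.
Unset Strict Implicit.
Unset Printing Implicit Defensive.

Record simple_graph := SimpleGraph {
  vertex :> finType;
  adj : rel vertex;
  adj_sym : symmetric adj;
  adj_irr : irreflexive adj
}.

Definition edges (G : simple_graph) : {set {set G}} :=
  [set [set p.1; p.2] | p : G * G & adj p.1 p.2].

Section CompleteMultipartite.
Variables r n : nat.

(* The vertex (i, a) is the a-th vertex of the i-th class. *)
Definition multipartite_adj : rel ('I_r * 'I_n) :=
  fun x y => x.1 != y.1.

Lemma multipartite_adj_sym : symmetric multipartite_adj.
Proof. by move=> x y; rewrite /multipartite_adj eq_sym. Qed.

Lemma multipartite_adj_irr : irreflexive multipartite_adj.
Proof. by move=> x; rewrite /multipartite_adj eqxx. Qed.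

Definition complete_multipartite : simple_graph :=
  SimpleGraph multipartite_adj_sym multipartite_adj_irr.

End CompleteMultipartite.

Record subgraph (G : simple_graph) := Subgraph {
  sub_vertices : {set G};
  sub_edges : {set {set G}};
  sub_edges_in : sub_edges \subset edges G;
  sub_edges_ends : cover sub_edges \subset sub_vertices
}.

Section RainbowIndex.
Variable G : simple_graph.

Definition sub_adj (H : subgraph G) : rel G :=
  fun x y => [set x; y] \in sub_edges H.

Definition connected (H : subgraph G) : Prop :=
  sub_vertices H != set0 /\
  {in sub_vertices H &, forall x y, connect (sub_adj H) x y}.

(* [ucycle] also holds of the sequences [::] and [:: x; y] with xy an edge,
   which are not graph cycles. *)
Definition acyclic (H : subgraph G) : Prop :=
  forall p : seq G, ucycle (sub_adj H) p -> size p < 3.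

Definition tree (H : subgraph G) : Prop := connected H /\ acyclic H.

(* A coloring is a total function on sets of vertices; only its values on
   edges are constrained or ever used. *)
Definition edge_coloring (t : nat) (c : {set G} -> nat) : Prop :=
  {in edges G, forall e, 1 <= c e <= t}.

Definition rainbow_tree (c : {set G} -> nat) (H : subgraph G) : Prop :=
  tree H /\ {in sub_edges H &, injective c}.

Definition rainbow_S_tree (c : {set G} -> nat) (S : {set G})
    (H : subgraph G) : Prop :=
  rainbow_tree c H /\ S \subset sub_vertices H.

Definition internally_disjoint (S : {set G}) (l : nat)
    (T : 'I_l -> subgraph G) : Prop :=
  forall i j : 'I_l, i != j ->
    sub_edges (T i) :&: sub_edges (T j) = set0 /\
    sub_vertices (T i) :&: sub_vertices (T j) = S.

Definition rainbow_colorable (k l t : nat) : Prop :=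
  exists2 c : {set G} -> nat, edge_coloring t c &
    forall S : {set G}, #|S| = k ->
      exists2 T : 'I_l -> subgraph G,
        forall i, rainbow_S_tree c S (T i) & internally_disjoint S T.

(* The index is a relation because some graphs have no suitable coloring with
   any number of colors. *)
Definition rainbow_index (k l t : nat) : Prop :=
  rainbow_colorable k l t /\
  forall t', rainbow_colorable k l t' -> t <= t'.

End RainbowIndex.

Definition rainbow_threshold (k r : nat) : rat :=
  ('C(r, 2)%:R * (Num.ceil (k%:R / r%:R : rat))%:~R ^+ 2
     / (Num.floor (k%:R / r%:R : rat))%:~R)%R.

(* Main.v *)
Require Import Defs.
From HB Require Import structures.
From mathcomp Require Import all_boot all_order all_algebra.
From mathcomp Require Import zify.
From Stdlib Require Import Classical.
Set Implicit Arguments.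
Unset Strict Implicit.
Unset Printing Implicit Defensive.

(** Upper bounds: for each k-set S exhibit linearly many internally disjoint
    S-trees with at most t edges.  If k < r and t = k these are stars centred in
    a class that S misses; if t = k + 1 they are double stars centred at an edge
    vw outside S, the vertices of S in the class of v being attached to w.  In a
    uniformly random t-coloring the probability that all the trees of one of the
    l blocks fail to be rainbow decays exponentially in n, while there are only
    polynomially many sets S.

    Lower bounds: a rainbow tree in t colors has at most t + 1 vertices.  With
    t < k no S-tree exists for S inside one class.  With t <= k and S spread
    evenly over the classes, an S-tree has at most one vertex v outside S, and
    each vertex of S in the class of v needs its own edge inside S; so an S-tree
    uses at least floor(k/r) of the at most C(r,2) ceil(k/r)^2 edges inside S. *)

(** * Counting the colorings that miss every prescribed pattern *)

Definition agree (T : finType) (q : nat) (D : {set T}) (c f : T -> 'I_q) :=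
  [forall x in D, f x == c x].

(** A uniformly random [f] agrees with [c i] on [D i] with probability at least [q ^ -d], and these
    events are independent because the [D i] are disjoint. So all of them fail with probability at
    most [(1 - q ^ -d) ^ size s], stated here with the denominators cleared. *)
Lemma card_all_fail (T I : finType) (q d : nat) (D : I -> {set T})
    (c : I -> T -> 'I_q) (s : seq I) :
  0 < q -> uniq s -> (forall i, #|D i| <= d) ->
  {in s &, forall i j, i != j -> [disjoint D i & D j]} ->
  #|[set f : {ffun T -> 'I_q} | all (fun i => ~~ agree (D i) (c i) f) s]|
    * (q ^ d) ^ size s <= (q ^ d).-1 ^ size s * q ^ #|T|.
Proof.
move=> q0 + leDd; elim: s => [|i s IHs] /=.
  move=> _ _; rewrite !expn0 muln1 mul1n.
  by apply: leq_trans (max_card _) _; rewrite card_ffun card_ord.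
case/andP=> nis us dis.
have sub j : j \in s -> j \in i :: s by rewrite inE orbC => ->.
have {}IHs := IHs us (fun j k js ks => dis j k (sub j js) (sub k ks)).
set A := [set f : {ffun T -> 'I_q} | _ s] in IHs.
pose B := A :&: [set f : {ffun T -> 'I_q} | agree (D i) (c i) f].
have -> : [set f : {ffun T -> 'I_q} | ~~ agree (D i) (c i) f &&
    all (fun i => ~~ agree (D i) (c i) f) s] = A :\: B.
  by apply/setP=> f; rewrite !inE; case: agree; case: all.
have BA : B \subset A by apply: subsetIl.
(* [over f] overwrites [f] by [c i] on [D i], and the second component of [h] keeps the values lost,
   so [h] is injective. As [D i] is disjoint from the later domains, [over] maps [A] into [B]; hence
   [#|A| <= #|B| * q ^ d]. *)
pose over (f : {ffun T -> 'I_q}) := [ffun x => if x \in D i then c i x else f x].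
pose h (f : {ffun T -> 'I_q}) := (over f, [ffun u : {x | x \in D i} => f (val u)]).
have h_inj : injective h.
  move=> f g [/ffunP fg1 /ffunP fg2]; apply/ffunP=> x.
  case: (boolP (x \in D i)) => xD.
    by have := fg2 (Sub x xD); rewrite !ffunE.
  by have := fg1 x; rewrite !ffunE (negPf xD).
have leA : #|A| <= #|B| * q ^ d.
  rewrite -(card_imset _ h_inj).
  apply: (@leq_trans #|setX B [set: {ffun {x | x \in D i} -> 'I_q}]|); last first.
    rewrite cardsX cardsT card_ffun card_ord card_sig leq_mul2l.
    by rewrite leq_pexp2l ?orbT //; apply: leDd.
  apply/subset_leq_card/subsetP=> _ /imsetP[f fA ->]; rewrite !inE andbT.
  apply/andP; split; last by apply/forall_inP=> x xD; rewrite ffunE xD.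
  move: fA; rewrite inE => /allP fA; apply/allP=> j js.
  apply: contra (fA j js) => /forall_inP aj; apply/forall_inP=> x xD.
  have ij : i != j by apply: contraNneq nis => ->.
  have /pred0P/(_ x)/= := dis i j (mem_head _ _) (sub j js) ij.
  by rewrite xD andbT => nx; have := aj x xD; rewrite ffunE nx.
have cAB : #|A :\: B| = #|A| - #|B| by rewrite cardsD (setIidPr BA).
have leBA := subset_leq_card BA.
have Q0 : 0 < q ^ d by rewrite expn_gt0 q0.
have step : #|A :\: B| * q ^ d <= (q ^ d).-1 * #|A|.
  by rewrite cAB; nia.
rewrite !expnS mulnA.
apply: leq_trans (_ : (q ^ d).-1 * #|A| * (q ^ d) ^ size s <= _).
  by rewrite leq_mul2r step orbT.
by rewrite -!mulnA leq_mul2l IHs orbT.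
Qed.

(** Bernoulli's inequality for [(1 + 1/Q) ^ w], raised to the power [k.+1], gives growth of degree
    [k.+1] in [w], which beats degree [k] once [w] is large; [m] is [k.+1 * w], with [w] linear in
    [n]. *)
Lemma poly_lt_exp (a l r k Q : nat) : 0 < Q -> 0 < l ->
  exists N, forall n, N <= n -> exists m,
    a + l * m <= n /\ (r * n) ^ k * l * Q ^ m < Q.+1 ^ m.
Proof.
move=> Q0 l0.
(* [D] is chosen so that [n <= D * w], and [W] so that [W <= w] forces [w ^ k.+1] above
   [Q ^ k.+1 * l * (r * D) ^ k * w ^ k]. *)
pose D := a + 2 * l * k.+1.
pose W := (Q ^ k.+1 * l * (r * D) ^ k).+1.
exists (a + l * k.+1 * W) => n len.
pose w := (n - a) %/ (l * k.+1).
have lk : 0 < l * k.+1 by rewrite muln_gt0 l0.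
have leW : W <= w by rewrite leq_divRL //; nia.
have lew : w * (l * k.+1) <= n - a by apply: leq_trunc_div.
have ltw : n - a < w.+1 * (l * k.+1) by rewrite -ltn_divLR.
exists (k.+1 * w); split; first by nia.
have w0 : 0 < w by apply: leq_trans leW.
have leD : n <= D * w by rewrite /D; nia.
have bern : forall v, Q ^ v * v <= Q * Q.+1 ^ v.
  have bern0 : forall v, Q ^ v * (Q + v) <= Q * Q.+1 ^ v.
    elim=> [|v IHv]; first by rewrite !expn0; lia.
    rewrite !expnS; nia.
  by move=> v; apply: leq_trans (bern0 v); rewrite leq_mul2l leq_addl orbT.
have := bern w; rewrite -(leq_exp2r _ _ (ltn0Sn k)) !expnMn -!expnM => le1.
rewrite [k.+1 * w]mulnC.
have Qk : 0 < Q ^ k.+1 by rewrite expn_gt0 Q0.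
have Qm : 0 < Q ^ (w * k.+1) by rewrite expn_gt0 Q0.
have wk : 0 < w ^ k by rewrite expn_gt0 w0.
rewrite -(ltn_pmul2l Qk); apply: leq_trans le1.
rewrite mulnA mulnC ltn_pmul2l // [w ^ _]expnS.
apply: (@leq_trans (W * w ^ k)); last by rewrite leq_mul2r leW orbT.
rewrite /W mulSn -addn1 addnC leq_add //.
have : (r * n) ^ k <= (r * D) ^ k * w ^ k.
  by rewrite -expnMn; case: (k) => // k'; rewrite leq_exp2r // -mulnA leq_mul2l leD orbT.
by move=> le2; rewrite -expnMn -!mulnA leq_mul2l [_ * l]mulnC leq_mul2l le2 !orbT.
Qed.

(** * Trees described by a parent function and a decreasing rank *)

Lemma parent_tree (G : simple_graph) (V : {set G}) (root : G) (p : G -> G)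
    (d : G -> nat) :
  root \in V ->
  (forall x, x \in V -> x != root ->
     [/\ p x \in V, adj x (p x) & d (p x) < d x]) ->
  exists2 H : subgraph G, tree H &
    sub_vertices H = V /\ sub_edges H = [set [set x; p x] | x in V :\ root].
Proof.
move=> rV hp; pose E := [set [set x; p x] | x in V :\ root].
have EP e : reflect (exists x, [/\ x \in V, x != root & e = [set x; p x]]) (e \in E).
  apply: (iffP imsetP) => [[x /setD1P[xr xV] ->]|[x [xV xr ->]]]; exists x => //.
  by rewrite !inE xr.
have Ein : E \subset edges G.
  apply/subsetP=> e /EP[x [xV xr ->]]; have [_ xp _] := hp x xV xr.
  by apply/imsetP; exists (x, p x); rewrite ?inE.
have Eends : cover E \subset V.
  apply/bigcupsP=> e /EP[x [xV xr ->]]; have [pV _ _] := hp x xV xr.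
  by apply/subsetP=> y; rewrite !inE => /orP[] /eqP->.
exists (Subgraph Ein Eends) => //; set H := Subgraph Ein Eends.
have Hsym : symmetric (sub_adj H) by move=> x y; rewrite /sub_adj setUC.
(* Every edge joins a vertex to its parent, and the parent is the end of smaller rank. *)
have HP x y : sub_adj H x y -> d y <= d x -> y = p x.
  case/EP=> u [uV ur /setP eu]; have [pV up dpu] := hp u uV ur.
  have := eu x; have := eu y; have := eu (p u); have := eu u; rewrite !inE !eqxx !orbT /=.
  have pu : p u != u by apply: contraTneq dpu => ->; rewrite ltnn.
  case: (eqVneq x u) => [->|xu].
    by move=> _ + _ _; rewrite (negPf pu) => /eqP.
  move=> /= /eqP uy; subst y => _ _.
  by move/esym/eqP=> ->; rewrite leqNgt dpu.
split; first split.
- by apply/set0Pn; exists root.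
- have toroot : forall n x, x \in V -> d x <= n -> connect (sub_adj H) x root.
    elim=> [|n IHn] x xV dx; case: (eqVneq x root) => [->|xr] //;
      have [pV _ dp] := hp x xV xr; first by lia.
    apply: connect_trans (connect1 _) (IHn (p x) pV _); last by lia.
    by apply/EP; exists x.
  move=> x y xV yV; apply: connect_trans (toroot _ x xV (leqnn _)) _.
  by rewrite (sym_connect_sym Hsym); apply: (toroot _ y yV (leqnn _)).
(* On a cycle of length at least 3, rotated to start at a vertex [x] of maximal rank, the two
   neighbours of [x] would both equal [p x]. *)
move=> s /andP[cs us]; rewrite ltnNge; apply/negP=> s3.
have [x0 x0s] : exists x0, x0 \in s by case: (s) s3 => // a l _; exists a; apply: mem_head.
have [x xs xmax] : exists2 x, x \in s & forall y, y \in s -> d y <= d x.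
  by case: (arg_maxnP d x0s) => x; exists x.
have [i t rt] := rot_to xs.
have ut : uniq (x :: t) by rewrite -rt rot_uniq.
have ct : cycle (sub_adj H) (x :: t) by rewrite -rt rot_cycle.
have st : size (x :: t) = size s by rewrite -rt size_rot.
have mt y : y \in x :: t -> d y <= d x by rewrite -rt mem_rot; apply: xmax.
case: t ut ct st mt {rt} => [|y [|z t]] /= ut ct st mt; [by lia|by lia|].
move: ct; rewrite rcons_path => /and3P[xy _ /= /andP[_ tx]].
have yE : y = p x by apply: HP xy (mt _ _); rewrite !inE eqxx orbT.
have tE : last z t = p x.
  by apply: HP (mt _ _); [rewrite Hsym|rewrite 2!in_cons mem_last !orbT].
by case/and3P: ut => _; rewrite yE -tE mem_last.
Qed.

(** * The union bound and random colorings *)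

Lemma exists_avoiding (U X : finType) (F : U -> {set X}) :
  \sum_u #|F u| < #|X| -> exists x, forall u, x \notin F u.
Proof.
move=> ltFX; suff /existsP[x /forallP Fx] : [exists x, [forall u, x \notin F u]].
  by exists x.
apply: contraTT ltFX; rewrite negb_exists -leqNgt => /forallP hx.
have -> : \sum_u #|F u| = \sum_u \sum_x (x \in F u : nat).
  by apply: eq_bigr => u _; rewrite -sum1_card big_mkcond.
rewrite exchange_big -sum1_card; apply: leq_sum => x _.
have := hx x; rewrite negb_forall => /existsP[u]; rewrite negbK => xu.
by rewrite (bigD1 u) //= xu.
Qed.

Lemma card_subsets_le (T : finType) (k : nat) :
  #|{: {S : {set T} | #|S| == k}}| <= #|T| ^ k.
Proof.
rewrite card_sig -(card_tuple k T) -cardsT.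
apply: leq_trans (leq_imset_card (fun t : k.-tuple T => [set x in t]) _).
apply/subset_leq_card/subsetP=> S; rewrite inE => /eqP cS.
have sS : size (enum S) == k by rewrite -cardE cS.
apply/imsetP; exists (Tuple sS) => //.
by apply/setP=> x; rewrite inE -(mem_enum S).
Qed.

Lemma exists_inj_ord (T : finType) (t : nat) (E : {set T}) :
  0 < t -> #|E| <= t -> exists c : T -> 'I_t, {in E &, injective c}.
Proof.
(* The default [Ordinal t0] can be taken only outside [E], where nothing is required. *)
move=> t0 Et; exists (fun x => insubd (Ordinal t0) (index x (enum E))).
have lt x : x \in E -> index x (enum E) < t.
  by move=> xE; apply: leq_trans Et; rewrite cardE index_mem mem_enum.
move=> x y xE yE /(congr1 val); rewrite !val_insubd !lt //.
by apply: (index_inj x); rewrite mem_enum.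
Qed.

Lemma exists_inj_set (I T : finType) (A : {set T}) :
  #|I| <= #|A| -> exists2 g : I -> T, injective g & forall i, g i \in A.
Proof.
move=> IA; exists (fun i => enum_val (widen_ord IA (enum_rank i))).
  move=> i j /enum_val_inj/(congr1 val)/= /val_inj.
  exact: enum_rank_inj.
by move=> i; apply: enum_valP.
Qed.

(** For each [S] the trees come in [l] blocks of [m]. Fixing an injective pattern in [t] colors on
    each tree, a block contains no tree with its pattern with probability at most
    [(1 - t ^ -t) ^ m]. The numerical hypothesis is the union bound over the at most [#|G| ^ k * l]
    pairs of a set and a block. *)
Lemma rainbow_colorable_templates (G : simple_graph) (k l m t : nat) :
  0 < t -> #|G| ^ k * l * (t ^ t).-1 ^ m < (t ^ t) ^ m ->
  (forall S : {set G}, #|S| = k ->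
    exists2 T : 'I_l * 'I_m -> subgraph G,
      forall i, [/\ tree (T i), S \subset sub_vertices (T i)
                  & #|sub_edges (T i)| <= t]
    & forall i j, i != j ->
        sub_edges (T i) :&: sub_edges (T j) = set0 /\
        sub_vertices (T i) :&: sub_vertices (T j) = S) ->
  rainbow_colorable G k l t.
Proof.
move=> t0 small hS.
have /fin_all_exists2[T hT Tdis] : forall S : {S : {set G} | #|S| == k},
    exists2 T : 'I_l * 'I_m -> subgraph G,
      forall i, [/\ tree (T i), val S \subset sub_vertices (T i)
                  & #|sub_edges (T i)| <= t]
    & forall i j, i != j ->
        sub_edges (T i) :&: sub_edges (T j) = set0 /\
        sub_vertices (T i) :&: sub_vertices (T j) = val S.
  by move=> S; apply/hS/eqP/(valP S).
have /fin_all_exists[c c_inj] :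
    forall u : {S : {set G} | #|S| == k} * ('I_l * 'I_m),
      exists c : {set G} -> 'I_t, {in sub_edges (T u.1 u.2) &, injective c}.
  by move=> u; apply: exists_inj_ord => //; case: (hT u.1 u.2).
pose F (u : {S : {set G} | #|S| == k} * 'I_l) :=
  [set f : {ffun {set G} -> 'I_t} |
    all (fun j => ~~ agree (sub_edges (T u.1 (u.2, j))) (c (u.1, (u.2, j))) f)
      (enum 'I_m)].
have leF u : #|F u| * (t ^ t) ^ m <= (t ^ t).-1 ^ m * t ^ #|{set G}|.
  have := @card_all_fail _ _ t t (fun j => sub_edges (T u.1 (u.2, j)))
    (fun j => c (u.1, (u.2, j))) _ t0 (enum_uniq 'I_m).
  rewrite size_enum_ord; apply=> [j|i j _ _ ij]; first by case: (hT u.1 (u.2, j)).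
  rewrite -setI_eq0; apply/eqP.
  have ne : (u.2, i) != (u.2, j) by rewrite xpair_eqE eqxx.
  by case: (Tdis u.1 _ _ ne).
have [f hf] : exists f, forall u, f \notin F u.
  apply: exists_avoiding; rewrite card_ffun card_ord.
  have Q0 : 0 < (t ^ t) ^ m by rewrite !expn_gt0 t0.
  rewrite -(ltn_pmul2r Q0) big_distrl /=.
  apply: (@leq_ltn_trans (\sum_(u : {S : {set G} | #|S| == k} * 'I_l)
      (t ^ t).-1 ^ m * t ^ #|{set G}|)); first exact: leq_sum.
  rewrite sum_nat_const card_prod card_ord mulnC.
  rewrite mulnAC [X in _ < X]mulnC ltn_pmul2r ?expn_gt0 ?t0 // mulnC.
  by apply: leq_ltn_trans small; rewrite !leq_mul2r card_subsets_le !orbT.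
(* The successor moves the values from [0..t-1] to the colors [1..t]. *)
exists (fun e => (f e).+1) => [e _|S cS]; first exact: ltn_ord.
have pS : #|S| == k by apply/eqP.
pose S' : {S : {set G} | #|S| == k} := Sub S pS.
have /fin_all_exists[j hj] : forall i : 'I_l, exists j : 'I_m,
    agree (sub_edges (T S' (i, j))) (c (S', (i, j))) f.
  move=> i; have := hf (S', i); rewrite inE => /allPn[j _ /negPn aj].
  by exists j.
exists (fun i => T S' (i, j i)) => [i|i i' ne].
  have [tr sub _] := hT S' (i, j i); do 2!split=> //.
  move=> e e' eE eE' [/val_inj].
  have /forall_inP ag := hj i.
  rewrite (eqP (ag e eE)) (eqP (ag e' eE')); exact: (c_inj (S', (i, j i))).
by apply: Tdis; rewrite xpair_eqE negb_and ne.
Qed.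

(** * Upper bounds: stars and double stars *)

Lemma disjoint_attachments (G : simple_graph) (I : eqType) (S : {set G})
    (X : I -> {set G}) (T : I -> subgraph G) :
  (forall i, [disjoint X i & S]) ->
  (forall i j, i != j -> [disjoint X i & X j]) ->
  (forall i, sub_vertices (T i) = S :|: X i) ->
  (forall i e, e \in sub_edges (T i) -> exists2 x, x \in e & x \in X i) ->
  forall i j, i != j ->
    sub_edges (T i) :&: sub_edges (T j) = set0 /\
    sub_vertices (T i) :&: sub_vertices (T j) = S.
Proof.
move=> XS XX VT ET i j ij.
have VS : sub_vertices (T i) :&: sub_vertices (T j) = S.
  rewrite !VT -setUIr; apply/setUidPl.
  by have := XX i j ij; rewrite -setI_eq0 => /eqP->; apply: sub0set.
(* A common edge has an end in [X i]; that end is a vertex of both trees, hence in [S], which [X i]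
   avoids. *)
split=> //; apply/setP=> e; rewrite in_set0; apply/negbTE/negP.
case/setIP=> ei ej; have [x xe xX] := ET i e ei.
have : x \in sub_vertices (T i) :&: sub_vertices (T j).
  rewrite inE; apply/andP; split.
    by rewrite VT inE xX orbT.
  by apply: (subsetP (sub_edges_ends (T j))); apply/bigcupP; exists e.
by rewrite VS => xS; have /pred0P/(_ x) := XS i; rewrite /= xX xS.
Qed.

Lemma card_parent_edges (G : finType) (V : {set G}) (root : G) (p : G -> G) :
  root \in V -> #|[set [set x; p x] | x in V :\ root]| <= #|V|.-1.
Proof.
by move=> rV; apply: leq_trans (leq_imset_card _ _) _; rewrite (cardsD1 root V) rV.
Qed.

(** Placing all parents in [X i] makes the vertices of [S] leaves and gives each edge an end in
    [X i], which yields edge-disjointness. A tree on at most [t.+1] vertices has at most [t]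
    edges. *)
Lemma templates_of_parents (G : simple_graph) (I : finType) (S : {set G})
    (t : nat) (X : I -> {set G}) (root : I -> G) (p : I -> G -> G)
    (d : I -> G -> nat) :
  (forall i, [disjoint X i & S]) ->
  (forall i j, i != j -> [disjoint X i & X j]) ->
  (forall i, root i \in X i) ->
  (forall i, #|S| + #|X i| <= t.+1) ->
  (forall i x, x \in S :|: X i -> x != root i ->
     [/\ p i x \in X i, adj x (p i x) & d i (p i x) < d i x]) ->
  exists2 T : I -> subgraph G,
    forall i, [/\ tree (T i), S \subset sub_vertices (T i)
                & #|sub_edges (T i)| <= t]
  & forall i j, i != j ->
      sub_edges (T i) :&: sub_edges (T j) = set0 /\
      sub_vertices (T i) :&: sub_vertices (T j) = S.
Proof.
move=> XS XX rX cX hp.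
have rV i : root i \in S :|: X i by rewrite inE rX orbT.
have /fin_all_exists2[T trT hT] : forall i, exists2 H : subgraph G, tree H &
    sub_vertices H = S :|: X i /\
    sub_edges H = [set [set x; p i x] | x in (S :|: X i) :\ root i].
  move=> i; apply: (@parent_tree _ _ _ _ (d i)) => // x xV xr.
  by have [pX ad dp] := hp i x xV xr; rewrite inE pX orbT.
exists T => [i|].
  have [-> ->] := hT i; split=> //; first exact: subsetUl.
  apply: leq_trans (card_parent_edges _ (rV i)) _.
  by have := cX i; rewrite cardsU; lia.
apply: (disjoint_attachments XS XX) => [i|i e]; first by case: (hT i).
have [_ ->] := hT i; case/imsetP=> x /setD1P[xr xV] ->.
by exists (p i x); [rewrite !inE eqxx orbT|case: (hp i x xV xr)].
Qed.

Lemma free_vertices (I : finType) (r n : nat) (S : {set 'I_r * 'I_n}) (j : 'I_r) :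
  #|S| + #|I| <= n ->
  exists2 g : I -> 'I_r * 'I_n, injective g & forall i, (g i).1 = j /\ g i \notin S.
Proof.
move=> leSI; pose A := setX [set j] [set: 'I_n] :\: S.
have cA : #|I| <= #|A|.
  have := cardsID S (setX [set j] [set: 'I_n]).
  rewrite cardsX cards1 cardsT card_ord mul1n -/A.
  rewrite -(leq_add2l #|setX [set j] [set: 'I_n] :&: S|) => ->.
  by apply: leq_trans leSI; rewrite leq_add2r subset_leq_card ?subsetIr.
have [g g_inj gA] := exists_inj_set cA; exists g => // i.
by have := gA i; rewrite !inE andbT => /andP[-> /eqP->].
Qed.

Lemma colorable_star (k l r n m : nat) :
  0 < k -> k < r -> k + l * m <= n ->
  (r * n) ^ k * l * (k ^ k).-1 ^ m < (k ^ k) ^ m ->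
  rainbow_colorable (complete_multipartite r n) k l k.
Proof.
move=> k0 kr len small; apply: (rainbow_colorable_templates (m := m)) => //.
  by rewrite /= card_prod !card_ord.
move=> S cS.
(* Since [#|S| = k < r], some class [j] misses [S]; its vertices are adjacent to all of [S]. *)
have [j hj] : exists j : 'I_r, forall x, x \in S -> x.1 != j.
  have /subsetPn[j _ jS] : ~~ ([set: 'I_r] \subset [set x.1 | x in S]).
    apply: contraL kr => /subset_leq_card; rewrite cardsT card_ord -leqNgt => le.
    by rewrite -cS; apply: leq_trans le (leq_imset_card _ _).
  by exists j => x xS; apply: contraNneq jS => <-; apply: imset_f.
have [|g g_inj gP] := @free_vertices ('I_l * 'I_m)%type r n S j.
  by rewrite cS card_prod !card_ord.
apply: (@templates_of_parents _ _ S k (fun i => [set g i]) g (fun i _ => g i)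
  (fun i x => x != g i)) => [i|i i' ne|i|i|i x].
- by rewrite disjoints1; case: (gP i).
- by rewrite disjoints1 inE (inj_eq g_inj).
- by rewrite inE.
- by rewrite cards1 cS addn1.
- rewrite !inE => /orP[xS ne|->//]; rewrite eqxx ne; split=> //.
  by rewrite /= /multipartite_adj; case: (gP i) => -> _; apply: hj.
Qed.

Lemma colorable_double_star (k l r n m : nat) :
  2 <= r -> k + l * m <= n ->
  (r * n) ^ k * l * (k.+1 ^ k.+1).-1 ^ m < (k.+1 ^ k.+1) ^ m ->
  rainbow_colorable (complete_multipartite r n) k l k.+1.
Proof.
move=> r2 len small; apply: (rainbow_colorable_templates (m := m)) => //.
  by rewrite /= card_prod !card_ord.
move=> S cS.
pose j : 'I_r := Ordinal (ltnW r2); pose j' : 'I_r := Ordinal r2.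
have lt_n : #|S| + #|{: 'I_l * 'I_m}| <= n by rewrite cS card_prod !card_ord.
have [v v_inj vP] := free_vertices j lt_n.
have [w w_inj wP] := free_vertices j' lt_n.
have vw i i' : v i != w i'.
  by apply/eqP=> /(congr1 fst); case: (vP i) => -> _; case: (wP i') => -> _.
(* The root is [v i]. Vertices in its class hang from [w i], and all others, including [w i] itself,
   from [v i]. The ranks are 0 at [v i], 1 at [w i] and 2 on [S]. *)
apply: (@templates_of_parents _ _ S k.+1 (fun i => [set v i; w i]) v
  (fun i x => if x.1 == j then w i else v i)
  (fun i x => if x == v i then 0 else if x == w i then 1 else 2))
  => [i|i i' ne|i|i|i x].
- rewrite -setI_eq0; apply/eqP/setP=> x; rewrite !inE.
  apply/negbTE/negP=> /andP[/orP[]/eqP-> xS]; last by case: (wP i); rewrite xS.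
  by case: (vP i); rewrite xS.
- rewrite -setI_eq0; apply/eqP/setP=> x; rewrite !inE.
  apply/negbTE/negP=> /andP[/orP[]/eqP->]; last first.
    by rewrite eq_sym (negPf (vw _ _)) (inj_eq w_inj) (negPf ne).
  by rewrite (negPf (vw _ _)) (inj_eq v_inj) (negPf ne).
- by rewrite !inE eqxx.
- by rewrite cards2 cS vw; lia.
rewrite !inE => xV xv; rewrite (negPf xv).
have [vj vS] := vP i; have [wj wS] := wP i.
case: (eqVneq x.1 j) => xj; rewrite !eqxx ?orbT /= /multipartite_adj.
  have xw : x != w i by apply: contra_eqN xj => /eqP->; rewrite wj.
  by rewrite (negPf xw) (eq_sym (w i)) (negPf (vw _ _)) xj wj.
by rewrite vj xj; split=> //; case: eqP.
Qed.

(** * Lower bounds: sizes of rainbow trees and edges inside [S] *)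

Lemma sub_adjP (G : simple_graph) (H : subgraph G) (x y : G) :
  sub_adj H x y -> [/\ x \in sub_vertices H, y \in sub_vertices H & adj x y].
Proof.
move=> xy; have inV z : z \in [set x; y] -> z \in sub_vertices H.
  move=> zxy; apply: (subsetP (sub_edges_ends H)).
  by apply/bigcupP; exists [set x; y].
rewrite !inV ?inE ?eqxx ?orbT //; split=> //.
have /imsetP[[a b]] := subsetP (sub_edges_in H) _ xy; rewrite inE /= => ab /setP e.
have := e x; have := e a; have := e b; rewrite !inE !eqxx orbT /=.
have nab : a != b by apply: contraTneq ab => ->; rewrite adj_irr.
move=> bxy axy /esym/orP[]/eqP xE; subst x.
  by move: bxy; rewrite eq_sym (negPf nab) => /eqP <-.
by move: axy; rewrite (negPf nab) => /eqP <-; rewrite adj_sym.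
Qed.

Lemma connected_edge (G : simple_graph) (H : subgraph G) (x : G) :
  connected H -> x \in sub_vertices H -> 1 < #|sub_vertices H| ->
  exists y, sub_adj H x y.
Proof.
move=> [_ conH] xV; rewrite (cardsD1 x) xV ltnS => /card_gt0P[y /setD1P[yx yV]].
have /connectP[[|z s] /= ] := conH x y xV yV; first by move=> _ yE; rewrite yE eqxx in yx.
by case/andP=> xz _ _; exists z.
Qed.

(** A vertex set is grown from a single vertex, one neighbour at a time; each new vertex brings an
    edge not contained in the previous set. *)
Lemma connected_card (G : simple_graph) (H : subgraph G) :
  connected H -> #|sub_vertices H| <= #|sub_edges H|.+1.
Proof.
move=> [/set0Pn[x0 x0V] conH].
pose E (A : {set G}) := [set e in sub_edges H | e \subset A].
suff grow m : m.+1 <= #|sub_vertices H| -> exists A : {set G},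
    [/\ A \subset sub_vertices H, #|A| = m.+1 & m <= #|E A|].
  have V0 : 0 < #|sub_vertices H| by apply/card_gt0P; exists x0.
  have [|A [_ _ leE]] := grow #|sub_vertices H|.-1; first by rewrite prednK.
  rewrite -(prednK V0) ltnS; apply: leq_trans leE _; apply/subset_leq_card.
  by apply/subsetP=> e; rewrite inE => /andP[].
elim: m => [|m IHm] ltm; first by exists [set x0]; rewrite sub1set cards1.
have [A [AV cA leE]] := IHm (ltnW ltm).
have [x [y [xA yA xy]]] : exists x y, [/\ x \in A, y \notin A & sub_adj H x y].
  have [a aA] : exists a, a \in A by apply/card_gt0P; rewrite cA.
  have /subsetPn[b bV bA] : ~~ (sub_vertices H \subset A).
    by apply: contraL ltm => /subset_leq_card; rewrite cA -leqNgt.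
  case: (boolP [exists x, exists y, [&& x \in A, y \notin A & sub_adj H x y]]).
    by case/existsP=> x /existsP[y /and3P[? ? ?]]; exists x, y.
  move=> none; have Hsym : symmetric (sub_adj H).
    by move=> x y; rewrite /sub_adj setUC.
  (* If no edge of [H] left [A], then [A] would be closed under adjacency, and [b] could not be
     reached from [a]. *)
  have clA : closed (sub_adj H) (mem A).
    apply: (intro_closed (sym_connect_sym Hsym)) => x y xy xA.
    apply: contraR none => yA; apply/existsP; exists x; apply/existsP; exists y.
    by apply/and3P.
  have := closed_connect clA (conH a b (subsetP AV a aA) bV).
  by rewrite /= aA (negPf bA).
have [_ yV _] := sub_adjP xy.
exists (y |: A); split; first by rewrite subUset sub1set yV.
  by rewrite cardsU1 yA cA.
apply: (@leq_trans #|[set x; y] |: E A|).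
  by rewrite cardsU1 inE subUset !sub1set (negPf yA) !andbF.
apply/subset_leq_card/subsetP=> e; rewrite !inE => /orP[/eqP->|/andP[-> eA]].
  by rewrite subUset !sub1set !inE eqxx xA orbT andbT.
by apply: subset_trans eA (subsetUr _ _).
Qed.

Lemma rainbow_tree_card (G : simple_graph) (t : nat) (c : {set G} -> nat)
    (H : subgraph G) :
  edge_coloring t c -> rainbow_tree c H -> #|sub_vertices H| <= t.+1.
Proof.
move=> colc [[conH _] injc]; apply: leq_trans (connected_card conH) _.
rewrite ltnS cardE -(size_map c) -(size_iota 1 t); apply: uniq_leq_size.
  rewrite map_inj_in_uniq ?enum_uniq // => e e'; rewrite !mem_enum.
  exact: injc.
move=> _ /mapP[e + ->]; rewrite mem_enum mem_iota => eE.
by have := colc e (subsetP (sub_edges_in H) e eE); lia.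
Qed.

Lemma rainbow_colorable_geq (k l r n t : nat) :
  0 < l -> 0 < r -> 2 <= k -> k <= n ->
  rainbow_colorable (complete_multipartite r n) k l t -> k <= t.
Proof.
move=> l0 r0 k2 kn [c colc hS]; rewrite leqNgt; apply/negP=> tk.
pose S := [set (Ordinal r0, widen_ord kn u) | u : 'I_k].
have cS : #|S| = k.
  by rewrite card_imset ?card_ord // => u v [] /val_inj.
have [T hT _] := hS S cS.
have [treeT ST] := hT (Ordinal l0); move: (T _) treeT ST => H treeH SH.
have leV := rainbow_tree_card colc treeH.
(* At most [t.+1 <= k] vertices leave room for [S] only, but [S] lies in one class and so spans no
   edge. *)
have VS : sub_vertices H = S.
  by apply/esym/eqP; rewrite eqEcard SH cS (leq_trans leV tk).
have conH : connected H by case: treeH => [[]].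
have [x xS] : exists x, x \in S by apply/card_gt0P; rewrite cS; lia.
have [||y xy] := @connected_edge _ H x conH; rewrite ?VS ?cS //.
have [xV yV] := sub_adjP xy; move: xV yV; rewrite VS.
by move=> /imsetP[u _ ->] /imsetP[v _ ->]; rewrite /= /multipartite_adj eqxx.
Qed.

(** At most one vertex of [H] lies outside [S]; take [j] to be its class. A vertex of [S] in class
    [j] is not adjacent to it, so its neighbours in [H] lie in [S], and distinct such vertices yield
    distinct edges. *)
Lemma inner_edges_geq (r n : nat) (S : {set complete_multipartite r n})
    (H : subgraph (complete_multipartite r n)) :
  0 < r -> connected H -> S \subset sub_vertices H -> 1 < #|sub_vertices H| ->
  #|sub_vertices H| <= #|S|.+1 ->
  exists j : 'I_r, #|[set x in S | x.1 == j]| <= #|[set e in sub_edges H | e \subset S]|.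
Proof.
move=> r0 conH SV V1 leV.
have [j hj] : exists j : 'I_r, forall v, v \in sub_vertices H -> v \notin S -> v.1 = j.
  have [sVS|/subsetPn[v vV vS]] := boolP (sub_vertices H \subset S).
    (* With no vertex outside [S], any class will do. *)
    by exists (Ordinal r0) => v vV; rewrite (subsetP sVS).
  exists v.1 => w wV wS; congr fst; apply/eqP; apply: contraLR leV => wv.
  rewrite -ltnNge; have -> : #|S|.+2 = #|w |: (v |: S)|.
    by rewrite !cardsU1 !inE (negPf wv) wS vS.
  by apply/subset_leq_card; rewrite !subUset !sub1set wV vV.
exists j.
have /fin_all_exists[h hP] : forall x : complete_multipartite r n,
    exists y, x \in sub_vertices H -> sub_adj H x y.
  move=> x; have [xV|] := boolP (x \in sub_vertices H); last by exists x.
  by have [y xy] := connected_edge conH xV V1; exists y.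
have hS x : x \in [set x in S | x.1 == j] ->
    [/\ [set x; h x] \in sub_edges H, h x \in S & (h x).1 != j].
  rewrite inE => /andP[xS /eqP xj]; have xh := hP x (subsetP SV x xS).
  have [_ hV] := sub_adjP xh; rewrite /= /multipartite_adj xj eq_sym => hj'.
  by split=> //; apply: contraR hj' => hS; apply/eqP/hj.
rewrite -(@card_in_imset _ _ (fun x => [set x; h x])).
  apply/subset_leq_card/subsetP=> _ /imsetP[x xS ->].
  have [xE hxS _] := hS x xS; rewrite inE xE subUset !sub1set hxS andbT /=.
  by move: xS; rewrite inE => /andP[].
(* If the edges chosen at [x] and [y] coincide with [x != y], then [x = h y], although [h y] is not
   in class [j]. *)
move=> x y xS yS /setP/(_ x); rewrite !inE eqxx /= => /esym/orP[/eqP//|/eqP xh].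
have [_ _] := hS y yS; rewrite -xh; move: xS; rewrite inE => /andP[_ ->].
by [].
Qed.

Lemma card_ord_ltn (n c : nat) : #|[set a : 'I_n | a < c]| <= c.
Proof.
rewrite cardE -(size_map val) -[c in X in _ <= X](size_iota 0); apply: uniq_leq_size.
  by rewrite (map_inj_uniq val_inj) enum_uniq.
by move=> _ /mapP[a + ->]; rewrite mem_enum inE mem_iota.
Qed.

Lemma card_inner_edges (r n c : nat) (S : {set complete_multipartite r n}) :
  (forall x, x \in S -> x.2 < c) ->
  #|[set e in edges (complete_multipartite r n) | e \subset S]| <= 'C(r, 2) * c ^ 2.
Proof.
move=> hS.
pose L := [set p : 'I_r * 'I_r | p.1 < p.2].
pose B := [set a : 'I_n | a < c].
have cL : #|L| <= 'C(r, 2).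
  (* The binomial is the sum of all [j < r], and [j] counts the pairs in [L] with larger entry
     [j]. *)
  rewrite -bin2_sum big_mkord -sum1_card big_mkcond /=.
  under eq_bigr => p _ do rewrite inE.
  rewrite -(pair_bigA _ (fun i j : 'I_r => if i < j then 1 else 0)) exchange_big /=.
  apply: leq_sum => j _; rewrite -big_mkcond sum1_card.
  by have := card_ord_ltn r j; rewrite cardsE.
apply: (@leq_trans #|setX L (setX B B)|); last first.
  by rewrite !cardsX -mulnn leq_mul // leq_mul // card_ord_ltn.
(* An edge inside [S] is coded by its two classes in increasing order and the positions of its ends,
   both below [c]. *)
pose F (q : ('I_r * 'I_r) * ('I_n * 'I_n)) := [set (q.1.1, q.2.1); (q.1.2, q.2.2)].
apply: leq_trans (leq_imset_card F _).
apply/subset_leq_card/subsetP=> e; rewrite inE => /andP[/imsetP[[x y]]].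
rewrite inE /= /multipartite_adj => xy -> {e}.
rewrite subUset !sub1set => /andP[/hS xc /hS yc].
case: x y xy xc yc => i a [j b] /= ij ac bc.
case: (ltngtP i j) => [lt|lt|eq].
- by apply/imsetP; exists ((i, j), (a, b)); rewrite ?inE //= lt ac bc.
- by apply/imsetP; exists ((j, i), (b, a)); rewrite ?inE /= ?lt ?ac ?bc // setUC.
by rewrite (val_inj eq) eqxx in ij.
Qed.

(** Numbering [(i, a)] by [a * r + i] runs through the classes cyclically, so the first [k] vertices
    meet each class in [floor(k/r)] or [ceil(k/r)] vertices. *)
Lemma balanced_set (r n k : nat) : 0 < r -> k <= n ->
  exists2 S : {set 'I_r * 'I_n}, #|S| = k & forall x, (x \in S) = (x.2 * r + x.1 < k).
Proof.
move=> r0 kn.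
have lt_n (u : 'I_k) : u %/ r < n.
  by apply: leq_ltn_trans (leq_div _ _) (leq_trans (ltn_ord u) kn).
pose F (u : 'I_k) := (Ordinal (ltn_pmod u r0), Ordinal (lt_n u)).
exists [set F u | u : 'I_k].
  rewrite card_imset ?card_ord // => u v [em ed]; apply: val_inj.
  by rewrite /= (divn_eq u r) (divn_eq v r) em ed.
move=> [i a] /=; apply/imsetP/idP => [[u _ [-> ->]] /=|lt_k].
  by rewrite -divn_eq.
exists (Ordinal lt_k) => //; congr pair; apply: val_inj => /=.
  by rewrite modnMDl modn_small.
by rewrite divnMDl // divn_small // addn0.
Qed.

(** Here [f] and [c] stand for [floor(k/r)] and [ceil(k/r)]. For the balanced [S], the [l]
    edge-disjoint trees each use at least [f] of the at most ['C(r, 2) * c ^ 2] edges inside [S]. *)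
Lemma rainbow_colorable_inner_edges (k l r n f c t : nat) :
  0 < r -> 2 <= k -> k <= n -> f * r <= k -> k <= c * r -> t <= k ->
  rainbow_colorable (complete_multipartite r n) k l t -> l * f <= 'C(r, 2) * c ^ 2.
Proof.
move=> r0 k2 kn fk kc tk [col colP hS].
have [S cS SP] := @balanced_set r n k r0 kn.
have [T hT Tdis] := hS S cS.
pose F i := [set e in sub_edges (T i) | e \subset S].
have leF i : f <= #|F i|.
  have [treeT ST] := hT i; have conT : connected (T i) by case: treeT => [[]].
  have leV := rainbow_tree_card colP treeT.
  have V1 : 1 < #|sub_vertices (T i)|.
    by apply: leq_trans (subset_leq_card ST); rewrite cS.
  have [|j] := inner_edges_geq r0 conT ST V1; first by rewrite cS (leq_trans leV).
  apply: leq_trans.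
  have fn : f <= n by nia.
  (* The first [f] vertices of class [j] are in [S]: for [a < f] and [j < r],
     [a * r + j < f * r <= k]. *)
  rewrite -[f]card_ord -(@card_imset _ _ (fun a : 'I_f => (j, widen_ord fn a))).
    apply/subset_leq_card/subsetP=> _ /imsetP[a _ ->].
    rewrite inE SP eqxx andbT /=.
    have := ltn_ord a; have := ltn_ord j; nia.
  by move=> a b [] /val_inj.
apply: (@leq_trans (\sum_i #|F i|)).
  by rewrite -[l in X in X <= _]card_ord -sum_nat_const leq_sum.
have -> : \sum_i #|F i| = #|\bigcup_i F i|.
  rewrite -sum1_card partition_disjoint_bigcup => [|i j ij].
    by apply: eq_bigr => i _; rewrite sum1_card.
  rewrite -setI_eq0 -subset0; have [<- _] := Tdis i j ij.
  by apply: setISS; apply/subsetP=> e; rewrite inE => /andP[].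
apply: leq_trans (card_inner_edges (c := c) (S := S) _); last first.
  move=> x; rewrite SP => lt_k.
  by rewrite -(ltn_pmul2r r0); apply: leq_trans kc; lia.
apply/subset_leq_card/bigcupsP=> i _; apply/subsetP=> e; rewrite !inE => /andP[eT ->].
by rewrite (subsetP (sub_edges_in (T i))).
Qed.

(** * The threshold in natural numbers, and the theorem *)

Import Order.TTheory GRing.Theory Num.Theory.

Lemma rainbow_threshold_nat (k r : nat) : 0 < r -> r <= k ->
  exists f c, [/\ f * r <= k, k <= c * r &
    forall l : nat, (rainbow_threshold k r < l%:R)%R -> 'C(r, 2) * c ^ 2 < l * f].
Proof.
move=> r0 rk; rewrite /rainbow_threshold; set x := (k%:R / r%:R : rat)%R.
have rp : (0 < r%:R :> rat)%R by rewrite ltr0n.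
have x1 : (1 <= x)%R by rewrite /x ler_pdivlMr // mul1r ler_nat.
have F0 : (0 < Num.floor x)%R by rewrite floor_gt0.
have leF := floor_le x; have leC := ceil_ge x.
have C0 : (0 <= Num.ceil x)%R.
  by rewrite -(ler_int rat); apply: le_trans leC; apply: le_trans x1.
(* Both integers are nonnegative, so they become naturals; the floor is positive because [r <= k],
   which allows multiplying the fraction out. *)
move: (Num.floor x) (Num.ceil x) F0 leF leC C0 => [f|//] [c|//] F0 leF leC _.
exists f, c; split.
- by move: leF; rewrite /x ler_pdivlMr // -natrM ler_nat.
- by move: leC; rewrite /x ler_pdivrMr // -natrM ler_nat.
move=> l; rewrite ltr_pdivrMr; last by rewrite ltr0z.
by rewrite -!natrX -!natrM ltr_nat.
Qed.

Theorem theorem3p1 (k l r : nat) (hk : 3 <= k) (hl : 0 < l) (hr : 3 <= r) :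
  exists2 N : nat, 0 < N & forall n : nat, N <= n ->
    [/\ k < r -> rainbow_index (complete_multipartite r n) k l k,
        r <= k -> (l%:R <= rainbow_threshold k r)%R ->
          rainbow_index (complete_multipartite r n) k l k \/
          rainbow_index (complete_multipartite r n) k l k.+1
      & r <= k -> (rainbow_threshold k r < l%:R)%R ->
          rainbow_index (complete_multipartite r n) k l k.+1].
Proof.
have r0 : 0 < r by apply: leq_trans hr.
have k0 : 0 < k by apply: leq_trans hk.
(* The growth estimate is applied with [Q = t ^ t - 1], for [t = k] and [t = k.+1]. *)
have predQ t : 2 < t -> 0 < (t ^ t).-1 /\ (t ^ t).-1.+1 = t ^ t.
  move=> t2; have : t ^ 1 <= t ^ t by rewrite leq_pexp2l; lia.
  by rewrite expn1; lia.
have [Q1 eQ1] := predQ k hk; have [Q2 eQ2] := predQ k.+1 (leqW hk).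
have [N1 hN1] := poly_lt_exp k r k Q1 hl; have [N2 hN2] := poly_lt_exp k r k Q2 hl.
rewrite eQ1 in hN1; rewrite eQ2 in hN2.
exists (maxn k (maxn N1 N2)) => [|n]; first by rewrite leq_max k0.
rewrite !geq_max => /and3P[kn /hN1[m1 [len1 small1]] /hN2[m2 [len2 small2]]].
have lb t : rainbow_colorable (complete_multipartite r n) k l t -> k <= t.
  by apply: rainbow_colorable_geq => //; apply: ltnW.
have ub : rainbow_colorable (complete_multipartite r n) k l k.+1.
  by apply: colorable_double_star len2 small2; apply: ltnW.
split=> [kr|rk _|rk lt_l].
- by split=> //; apply: colorable_star len1 small1.
(* The index is [k] or [k.+1] according to whether [k] colors suffice, which is decided by excluded
   middle. *)
- have [colk|ncolk] := classic (rainbow_colorable (complete_multipartite r n) k l k).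
    by left.
  right; split=> // t colt; rewrite ltn_neqAle lb // andbT.
  by apply/eqP=> kt; rewrite -kt in colt.
- split=> // t colt; rewrite ltnNge; apply/negP=> tk.
  have [f [c [fk kc /(_ l lt_l)]]] := rainbow_threshold_nat r0 rk.
  rewrite ltnNge => /negP; apply.
  exact: rainbow_colorable_inner_edges (ltnW hk) kn fk kc tk colt.
Qed.
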